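(* Let $(X,x)$ be a connected graph with base vertex $x$, let $f:(G,Y,y)\rightarrow(X,x)$ be a connected harmonic $G$-cover, and let $$1\rightarrow K\rightarrow G'\xrightarrow{\rho}G\rightarrow 1$$ be an exact sequence of finite groups. Then there exists a connected harmonic $G'$-cover of $(X,x)$ dominating $f$ via $\rho$. If $f$ is étale, then there exists a dominating étale $G'$-cover. Moreover, if the branch locus of $f$ is nonempty, then there exists a dominating $G'$-cover with the same branch locus as $f$.
   Context: A graph is a finite multigraph without loop edges. For a vertex $v$, $v(1)$ is the subgraph consisting of $v$, its neighbours and the edges incident to $v$. A morphism of graphs $\phi:Y\to X$ maps vertices to vertices and each edge with endpoints $y_1\ne y_2$ either to an edge with endpoints $\phi(y_1)\ne\phi(y_2)$ or to the vertex $\phi(y_1)=\phi(y_2)$. It is harmonic if for each vertex $y$ the number of edges of $y(1)$ mapped to $e'$ is independent of the edge $e'$ of $\phi(y)(1)$. For a finite group $G\le\mathrm{Aut}(Y)$, the quotient $G\backslash Y$ has vertices the orbits of vertices and edges the orbits of edges with endpoints in different orbits; $(G,Y)$ (with each component stabilizer acting faithfully on its component) is a harmonic action if every quotient morphism $Y\to H\backslash Y$, $H\le G$, is harmonic, and unflipped if no non-identity element of $G$ fixes an edge. A (connected) harmonic $G$-cover $f:(G,Y,y)\to(X,x)$ consists of a finite group $G$, a connected graph $Y$ with an unflipped harmonic action of $G\le \mathrm{Aut}(Y)$, a vertex $y$, and a harmonic morphism $f:Y\to X$ with $f(y)=x$ and $f(g\alpha)=f(\alpha)$ for all $g\in G$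 and all vertices/edges $\alpha$, such that the induced morphism $G\backslash Y\to X$ is an isomorphism. For $z\in V(X)$ the fiber $Y_z$ is the subgraph with vertices $f^{-1}(z)$ and the edges mapped to the vertex $z$. For $w\in V(Y)$, the inertia group $I_w$ is the stabilizer of $w$ in $G$ and the decomposition group $\Delta_w$ is the stabilizer of the connected component of $Y_{f(w)}$ containing $w$. The cover is étale if all inertia groups are trivial. A vertex $z$ of $X$ is totally split if $\Delta_w$ is trivial for $w$ over $z$; the branch locus (horizontal and vertical) of $f$ is the set of vertices $z\in V(X)$ that are not totally split, i.e. over which some vertex has nontrivial inertia or the fiber contains an edge. A harmonic $G'$-cover $f':(G',Y',y')\to(X,x)$ dominates $f$ via $\rho$ if there is a harmonic morphism $h:(Y',y')\to(Y,y)$ with $h(g\alpha)=\rho(g)h(\alpha)$ for all $g\in G'$ and vertices/edges $\alpha$, and $f\circ h=f'$. *)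

(* Defs.v *)
From mathcomp Require Import all_boot all_fingroup.

Set Implicit Arguments.
Unset Strict Implicit.
Unset Printing Implicit Defensive.

Import GroupScope.

(* Finite multigraphs without loop edges: parallel edges are distinct elements
   of [edge X] with the same (unordered) pair of endpoints. *)
Record mgraph := MGraph {
  vert : finType;
  edge : finType;
  ends : edge -> {set vert};
  card_ends : forall e, #|ends e| = 2
}.

Section Graph.
Variable X : mgraph.

Definition adj_in (A : {set edge X}) : rel (vert X) :=
  [rel u v | [exists e in A, ends e == [set u; v]]].

Definition component_in (A : {set edge X}) (v : vert X) : {set vert X} :=
  [set u | connect (adj_in A) v u].

Definition component (v : vert X) := component_in [set: edge X] v.

Definition connected := forall u v : vert X, u \in component v.

Lemma ends_neq0 (e : edge X) : exists v, v \in ends e.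
Proof. by apply/card_gt0P; rewrite card_ends. Qed.

Definition some_end (e : edge X) : vert X := xchoose (ends_neq0 e).

Lemma some_endP e : some_end e \in ends e.
Proof. exact: xchooseP. Qed.

End Graph.

(* An edge is sent to an edge ([inl]) or contracted to a vertex ([inr]). *)
Definition is_morphism (Y X : mgraph) (fV : vert Y -> vert X)
    (fE : edge Y -> edge X + vert X) :=
  forall e, fV @: ends e = match fE e with inl e' => ends e' | inr x => [set x] end.

Record gmorph (Y X : mgraph) := GMorph {
  vmap : vert Y -> vert X;
  emap : edge Y -> edge X + vert X;
  gmorphP : is_morphism vmap emap
}.

Definition eq_gmorph (Y X : mgraph) (f g : gmorph Y X) :=
  vmap f =1 vmap g /\ emap f =1 emap g.

Lemma gid_subproof (X : mgraph) :
  is_morphism (fun v : vert X => v) (fun e : edge X => inl e).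
Proof. by move=> e; rewrite imset_id. Qed.

Definition gid (X : mgraph) : gmorph X X := GMorph (@gid_subproof X).

Section Comp.
Variables (Z Y X : mgraph) (f : gmorph Y X) (h : gmorph Z Y).

Definition comp_emap (e : edge Z) : edge X + vert X :=
  match emap h e with inl e' => emap f e' | inr y => inr (vmap f y) end.

Lemma gcomp_subproof : is_morphism (vmap f \o vmap h) comp_emap.
Proof.
move=> e; rewrite /comp_emap imset_comp (gmorphP h).
by case: (emap h e) => [e'|y]; rewrite ?(gmorphP f) ?imset_set1.
Qed.

Definition gcomp : gmorph Z X := GMorph gcomp_subproof.

End Comp.

Definition is_isomorphism (Y X : mgraph) (f : gmorph Y X) :=
  exists g : gmorph X Y,
    eq_gmorph (gcomp g f) (gid Y) /\ eq_gmorph (gcomp f g) (gid X).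

Definition multiplicity (Y X : mgraph) (f : gmorph Y X) (y : vert Y)
    (e' : edge X) : nat :=
  #|[set e : edge Y | (y \in ends e) && (emap f e == inl e')]|.

Definition harmonic (Y X : mgraph) (f : gmorph Y X) :=
  forall (y : vert Y) (e1 e2 : edge X),
    vmap f y \in ends e1 -> vmap f y \in ends e2 ->
    multiplicity f y e1 = multiplicity f y e2.

(* MathComp actions are right actions; the left action of [g] is the right
   action of [g^-1].  All notions below are insensitive to this change. *)
Record gaction (gT : finGroupType) (Y : mgraph) := GAction {
  vact : {action gT &-> vert Y};
  eact : {action gT &-> edge Y};
  ends_eact : forall e g, ends (eact e g) = [set vact v g | v in ends e]
}.

Section Quotient.
Variables (gT : finGroupType) (Y : mgraph) (a : gaction gT Y) (H : {group gT}).

Definition vorbits : {set {set vert Y}} := [set orbit (vact a) H v | v : vert Y].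

Definition qvert : finType := {O : {set vert Y} | O \in vorbits}.

Lemma qvmap_subproof (v : vert Y) : orbit (vact a) H v \in vorbits.
Proof. exact: imset_f. Qed.

Definition qvmap (v : vert Y) : qvert := exist (fun O => O \in vorbits) _ (qvmap_subproof v).

(* the endpoints of e lie in different H-orbits *)
Definition transverse (e : edge Y) := #|qvmap @: ends e| == 2.

Definition eorbits : {set {set edge Y}} :=
  [set orbit (eact a) H e | e in transverse].

Definition qedge : finType := {A : {set edge Y} | A \in eorbits}.

Definition qends (A : qedge) : {set qvert} :=
  \bigcup_(e in val A) qvmap @: ends e.

Lemma qvmap_act v h : h \in H -> qvmap (vact a v h) = qvmap v.
Proof.
move=> hH; apply: val_inj => /=; apply/eqP; rewrite orbit_eq_mem.
exact: mem_orbit.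
Qed.

Lemma qvmap_ends e h : h \in H -> qvmap @: ends (eact a e h) = qvmap @: ends e.
Proof.
move=> hH; rewrite ends_eact -imset_comp; apply: eq_imset => v.
exact: qvmap_act.
Qed.

Lemma qendsE (A : qedge) e :
  val A = orbit (eact a) H e -> qends A = qvmap @: ends e.
Proof.
rewrite /qends => ->; apply/eqP; rewrite eqEsubset; apply/andP; split.
  by apply/bigcupsP => _ /imsetP[h hH ->]; rewrite qvmap_ends.
by apply: bigcup_sup; apply: orbit_refl.
Qed.

Lemma card_qends (A : qedge) : #|qends A| = 2.
Proof.
have /imsetP[e te Ae] := valP A.
by rewrite (qendsE Ae); apply/eqP.
Qed.

Definition qgraph : mgraph := MGraph card_qends.

Definition qemap (e : edge Y) : qedge + qvert :=
  match insub (orbit (eact a) H e) with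
  | Some A => inl A
  | None => inr (qvmap (some_end e))
  end.

Lemma quotient_subproof : is_morphism (Y := Y) (X := qgraph) qvmap qemap.
Proof.
move=> e; rewrite /qemap; case: insubP => [A _ Ae | nt] /=.
  by rewrite (qendsE Ae).
have le2 : #|qvmap @: ends e| <= 2.
  by rewrite -(card_ends e); apply: leq_imset_card.
have lt2 : #|qvmap @: ends e| <= 1.
  rewrite -ltnS ltn_neqAle le2 andbT; apply: contra nt => te.
  exact: imset_f.
apply/esym/eqP; rewrite eqEcard cards1 lt2 andbT sub1set.
exact/imset_f/some_endP.
Qed.

Definition quotient_map : gmorph Y qgraph := GMorph quotient_subproof.

End Quotient.

Section Action.
Variables (gT : finGroupType) (Y : mgraph) (a : gaction gT Y).

(* G is a subgroup of Aut(Y) *)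
Definition faithful_gaction :=
  forall g : gT, (forall v, vact a v g = v) -> (forall e, eact a e g = e) -> g = 1.

Definition component_faithful :=
  forall (v : vert Y) (g : gT),
    g \in 'N(component v | vact a) ->
    (forall u, u \in component v -> vact a u g = u) ->
    (forall e, ends e \subset component v -> eact a e g = e) -> g = 1.

Definition harmonic_action :=
  component_faithful /\ forall H : {group gT}, harmonic (quotient_map a H).

Definition unflipped := forall (e : edge Y) (g : gT), eact a e g = e -> g = 1.

(* action on an edge or a vertex *)
Definition cell_act (c : edge Y + vert Y) (g : gT) : edge Y + vert Y :=
  match c with inl e => inl (eact a e g) | inr v => inr (vact a v g) end.

End Action.

Definition invariant_gmorph (gT : finGroupType) (Y X : mgraph)
    (a : gaction gT Y) (f : gmorph Y X) :=
  (forall v g, vmap f (vact a v g) = vmap f v) /\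
  (forall e g, emap f (eact a e g) = emap f e).

(* The induced morphism is the unique one through which f factors, the quotient
   morphism being surjective on vertices and on edges. *)
Definition induced_iso (gT : finGroupType) (Y X : mgraph)
    (a : gaction gT Y) (f : gmorph Y X) :=
  exists fbar : gmorph (qgraph a [set: gT]%G) X,
    eq_gmorph (gcomp fbar (quotient_map a [set: gT]%G)) f /\ is_isomorphism fbar.

Record harmonic_cover (gT : finGroupType) (X : mgraph) (x : vert X) :=
  HarmonicCover {
    cgraph : mgraph;
    cact : gaction gT cgraph;
    cbase : vert cgraph;
    cmap : gmorph cgraph X;
    cover_connected : connected cgraph;
    cover_faithful : faithful_gaction cact;
    cover_harmonic_action : harmonic_action cact;
    cover_unflipped : unflipped cact;
    cover_harmonic : harmonic cmap;
    cover_base : vmap cmap cbase = x;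
    cover_invariant : invariant_gmorph cact cmap;
    cover_quotient : induced_iso cact cmap
  }.

Section Ramification.
Variables (gT : finGroupType) (X : mgraph) (x : vert X).
Variable f : harmonic_cover gT x.
Local Notation Y := (cgraph f).

Definition fiber_edges (z : vert X) : {set edge Y} :=
  [set e | emap (cmap f) e == inr z].

Definition fiber_component (w : vert Y) : {set vert Y} :=
  component_in (fiber_edges (vmap (cmap f) w)) w.

Definition inertia (w : vert Y) : {set gT} := 'C[w | vact (cact f)].

(* The stabilizer of a component of a fiber is the stabilizer of its vertex
   set, since G preserves the fiber. *)
Definition decomposition (w : vert Y) : {set gT} :=
  'N(fiber_component w | vact (cact f)).

Definition etale := forall w : vert Y, inertia w = 1.

Definition totally_split (z : vert X) : bool :=
  [forall (w | vmap (cmap f) w == z), decomposition w == 1].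

Definition branch_locus : {set vert X} := [set z | ~~ totally_split z].

End Ramification.

Definition dominates (gT' gT : finGroupType) (X : mgraph) (x : vert X)
    (rho : gT' -> gT) (f' : harmonic_cover gT' x) (f : harmonic_cover gT x) :=
  exists h : gmorph (cgraph f') (cgraph f),
    [/\ harmonic h,
        vmap h (cbase f') = cbase f,
        forall v g, vmap h (vact (cact f') v g) = vact (cact f) (vmap h v) (rho g),
        forall e g, emap h (eact (cact f') e g)
                    = cell_act (cact f) (emap h e) (rho g) &
        eq_gmorph (gcomp (cmap f) h) (cmap f')].

(* Main.v *)
Require Import Defs.
From mathcomp Require Import all_boot all_fingroup.

Set Implicit Arguments.
Unset Strict Implicit.
Unset Printing Implicit Defensive.

Import GroupScope.

(** Only the vertices of [Y] with trivial inertia are unwound: each such free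
    orbit is replaced by a copy of [G'], while a vertex [w] with nontrivial
    inertia keeps a single preimage, whose inertia is the full preimage of
    [I_w] under [rho]. The edges, on which [G] acts freely, are unwound in the
    same way, and then every edge of [Y] at [w] lifts to every vertex above [w].
    To make the result connected one adds edges, contracted by the map to [Y],
    joining one vertex [v0] to its translates under [K], and their translates
    under [G']. This enlarges decomposition groups only over the image of [v0]
    in [X], which may be chosen in the branch locus. As the actions are free on
    edges, all the maps involved are quotient maps up to isomorphism and
    contracted edges, hence harmonic. *)

(** * Preliminaries on connectivity and graph morphisms *)

Lemma morphim_full_surj (aT rT : finGroupType)
    (phi : {morphism [set: aT] >-> rT}) :
  phi @* [set: aT] = [set: rT] -> forall y, exists x, phi x = y.
Proof.
move=> phiT y; have : y \in phi @* [set: aT] by rewrite phiT inE.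
by case/morphimP=> x _ _ ->; exists x.
Qed.

Lemma connect_homo_connect (S T : finType) (r : rel S) (s : rel T)
    (phi : S -> T) :
  (forall u v, r u v -> connect s (phi u) (phi v)) ->
  forall u v, connect r u v -> connect s (phi u) (phi v).
Proof.
move=> rs u v /connectP[p rp ->]; elim: p u rp => [|w p IHp] u /=.
  by move=> _; apply: connect0.
by case/andP=> ruw /IHp; apply: connect_trans; apply: rs.
Qed.

Section Morphism.
Variables (Y X : mgraph) (f : gmorph Y X).

Lemma emap_edge_ends e e' : emap f e = inl e' -> ends e' = vmap f @: ends e.
Proof. by move=> fe; rewrite (gmorphP f) fe. Qed.

(** The two ends of [e] map onto the two ends of [e'], so they cannot be identified. *)
Lemma emap_edge_inj e e' :
  emap f e = inl e' -> {in ends e &, injective (vmap f)}.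
Proof.
by move=> fe; apply/imset_injP; rewrite -(emap_edge_ends fe) !card_ends.
Qed.

Lemma emap_vert_ends e z v : emap f e = inr z -> v \in ends e -> vmap f v = z.
Proof.
move=> fe ve; apply/set1P; move: (gmorphP f e); rewrite fe => <-.
exact: imset_f.
Qed.

End Morphism.

Lemma adj_in_sym (X : mgraph) (A : {set edge X}) : symmetric (adj_in A).
Proof.
by move=> u v; apply: eq_existsb => e; rewrite setUC.
Qed.

Lemma connect_adj_in_sym (X : mgraph) (A : {set edge X}) :
  connect_sym (adj_in A).
Proof. exact/sym_connect_sym/adj_in_sym. Qed.

Lemma adj_inP (X : mgraph) (A : {set edge X}) u v :
  reflect (exists2 e, e \in A & ends e = [set u; v]) (adj_in A u v).
Proof. exact: 'exists_in_eqP. Qed.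

Lemma ends_other (X : mgraph) (e : edge X) u :
  u \in ends e -> exists2 v, ends e = [set u; v] & u != v.
Proof.
move=> ue; have /cards2P[a [b [ab eab]]]: #|ends e| == 2 by rewrite card_ends.
move: ue; rewrite eab !inE => /orP[]/eqP->; first by exists b.
by exists a; [rewrite setUC | rewrite eq_sym].
Qed.

(** * Orbit maps: lifting, harmonicity, quotients *)

Lemma unflipped_inj (gT : finGroupType) (Y : mgraph) (a : gaction gT Y) :
  unflipped a -> forall e, injective (eact a e).
Proof.
move=> ufl e g h egh; apply/eqP; rewrite eq_mulgV1; apply/eqP/(ufl e).
by rewrite actM egh -actM mulgV act1.
Qed.

(* [f] is the quotient map by [H], up to isomorphism. *)
Record orbit_map (gT : finGroupType) (Y X : mgraph) (a : gaction gT Y)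
    (H : {group gT}) (f : gmorph Y X) : Prop := OrbitMap {
  om_vact : forall v g, g \in H -> vmap f (vact a v g) = vmap f v;
  om_eact : forall e g, g \in H -> emap f (eact a e g) = emap f e;
  om_vsurj : forall z, exists v, vmap f v = z;
  om_esurj : forall e', exists e, emap f e = inl e';
  om_vorbit : forall u v, vmap f u = vmap f v -> u \in orbit (vact a) H v;
  om_eorbit : forall d e e', emap f d = inl e' -> emap f e = inl e' ->
                d \in orbit (eact a) H e
}.

Section OrbitMap.
Variables (gT : finGroupType) (Y X : mgraph) (a : gaction gT Y).
Variables (H : {group gT}) (f : gmorph Y X).
Hypothesis omf : orbit_map a H f.

(** Some edge lies over [e']; one of its ends is in the orbit of [v], and a group element brings
    that end to [v]. *)
Lemma edge_lift v e' : vmap f v \in ends e' ->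
  exists2 e, v \in ends e & emap f e = inl e'.
Proof.
have [e fe] := om_esurj omf e'; rewrite (emap_edge_ends fe).
case/imsetP=> u ue /(om_vorbit omf)/orbitP[g gH <-].
exists (eact a e g); last by rewrite (om_eact omf).
by rewrite ends_eact; apply: imset_f.
Qed.

Lemma path_lift (A : {set edge X}) (B : {set edge Y}) :
  (forall e e', emap f e = inl e' -> e' \in A -> e \in B) ->
  forall u z, connect (adj_in A) (vmap f u) z ->
  exists2 v, vmap f v = z & connect (adj_in B) u v.
Proof.
move=> AB u z /connectP[p]; elim: p u => [|y p IHp] u /=.
  by move=> _ ->; exists u; rewrite ?connect0.
case/andP=> /adj_inP[e' e'A e'uy] pp lastp.
have [|e ue fe] := @edge_lift u e'; first by rewrite e'uy set21.
have [v euv uv] := ends_other ue.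
(* The far end of the lifted edge lies over [y], since [f] separates the ends of an edge it does not
   contract. *)
have fv : vmap f v = y.
  have: vmap f v \in ends e' by rewrite (emap_edge_ends fe) euv imset_f ?set22.
  rewrite e'uy !inE => /orP[]/eqP // fvu; case/eqP: uv.
  by apply: (emap_edge_inj fe); rewrite ?euv ?set21 ?set22.
rewrite -fv in pp lastp; have [w fw vw] := IHp v pp lastp.
exists w => //; apply: connect_trans vw; apply: connect1.
by apply/adj_inP; exists e => //; apply: AB fe e'A.
Qed.

(* An edge over [e'] at [v] is unique up to [H], and a group element moving it
   to another such edge must fix [v], the other end lying over another vertex. *)
Lemma orbit_map_multiplicity : unflipped a ->
  forall v e', vmap f v \in ends e' ->
  multiplicity f v e' = #|'C_H[v | vact a]|.
Proof.
move=> ufl v e' ve'; have [e ve fe] := edge_lift ve'.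
rewrite -(card_imset _ (unflipped_inj ufl (e := e))); apply: eq_card => d.
rewrite inE; apply/andP/imsetP => [[vd /eqP fd]|[g]].
  have /orbitP[g gH dE] := om_eorbit omf fd fe; exists g => //.
  rewrite inE gH; apply/astab1P.
  move: vd; rewrite -dE ends_eact => /imsetP[u ue vE].
  suff: v = u by move=> {1}->.
  by apply: (emap_edge_inj fe) => //; rewrite vE (om_vact omf).
case/setIP=> gH /astab1P gv ->; rewrite (om_eact omf) // fe; split=> //.
by rewrite ends_eact -{1}gv; apply: imset_f.
Qed.

(** The multiplicity is the order of a vertex stabilizer, which does not depend on the edge. *)
Lemma orbit_map_harmonic : unflipped a -> harmonic f.
Proof. by move=> ufl v e1 e2 v1 v2; rewrite !orbit_map_multiplicity. Qed.

End OrbitMap.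

Lemma quotient_orbit_map (gT : finGroupType) (Y : mgraph) (a : gaction gT Y)
  (H : {group gT}) : orbit_map a H (quotient_map a H).
Proof.
split=> /=.
- by move=> v g gH; apply: qvmap_act.
- move=> e g gH.
  have orb_eg : orbit (eact a) H (eact a e g) = orbit (eact a) H e.
    by apply/eqP; rewrite orbit_eq_mem mem_orbit.
  rewrite /qemap orb_eg; case: insubP => // nt; congr inr.
  (* The choice [some_end] need not commute with [g]; but all ends of a contracted edge have the
     same image, so the translate of [some_end e] can stand for the chosen end of the translated
     edge. *)
  have qeg : emap (quotient_map a H) (eact a e g)
             = inr (qvmap a H (some_end (eact a e g))).
    by rewrite /= /qemap orb_eg insubN.
  have qe : emap (quotient_map a H) e = inr (qvmap a H (some_end e)).
    by rewrite /= /qemap insubN.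
  rewrite -(emap_vert_ends qeg (v := vact a (some_end e) g)) /= ?qvmap_act //.
  by rewrite ends_eact; apply/imset_f/some_endP.
- by move=> O; have /imsetP[v _ vO] := valP O; exists v; apply: val_inj.
- move=> A; have /imsetP[e te eA] := valP A; exists e.
  rewrite /qemap; case: insubP => [B _ eB|]; last by rewrite imset_f.
  by congr inl; apply: val_inj; rewrite eB eA.
- by move=> u v /(congr1 val) /= uv; rewrite -orbit_eq_mem uv.
- move=> d e A; rewrite /qemap.
  case: insubP => // B _ dB [<-]; case: insubP => // C _ eC [CB].
  by rewrite -orbit_eq_mem -dB -eC CB.
Qed.

(** By connectedness the only component is all of [Y], and every quotient map is an orbit map of an
    action free on edges. *)
Lemma unflipped_harmonic_action (gT : finGroupType) (Y : mgraph)
    (a : gaction gT Y) :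
  connected Y -> faithful_gaction a -> unflipped a -> harmonic_action a.
Proof.
move=> cY fa ufl; split=> [v g _ gV gE|H].
  apply: fa => [u|e]; first exact: gV u (cY u v).
  by apply: gE; apply/subsetP=> u _; exact: cY u v.
exact: orbit_map_harmonic (quotient_orbit_map a H) ufl.
Qed.

(** * Orbit maps by the whole group versus the induced isomorphism *)

Section InducedIso.
Variables (gT : finGroupType) (Y X : mgraph) (a : gaction gT Y).
Variable (f : gmorph Y X).
Local Notation G := [set: gT]%G.

Lemma induced_iso_orbit_map :
  invariant_gmorph a f -> induced_iso a f -> orbit_map a G f.
Proof.
move=> [fV fE] [fbar [[eqV eqE] [r [[rfV rfE] [frV frE]]]]].
have omq := quotient_orbit_map a G.
(* An edge that [f] does not contract is not contracted by the quotient map either, because [fbar]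
   sends vertices to vertices; [r] then recovers its class. *)
have lift_edge e e' : emap f e = inl e' ->
    exists2 A, emap (quotient_map a G) e = inl A & emap r e' = inl A.
  rewrite -eqE /= /comp_emap; case qe: emap => [A|//] fA; exists A => //.
  by have := rfE A; rewrite /= /comp_emap fA.
split=> //.
- move=> z; have [v vz] := om_vsurj omq (vmap r z); exists v.
  by rewrite -eqV /= -[RHS]frV /= -vz.
- move=> e'; have := frE e'; rewrite /= /comp_emap; case: (emap r e') => // A fA.
  have [e eA] := om_esurj omq A; exists e.
  by rewrite -eqE /= /comp_emap eA.
- move=> u v; rewrite -!eqV /= => uv; apply: (om_vorbit omq).
  by rewrite -[LHS]rfV -[RHS]rfV /= uv.
- move=> d e e' /lift_edge[A dA rA] /lift_edge[B eB]; rewrite rA => -[AB].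
  by apply: (om_eorbit omq) dA _; rewrite AB.
Qed.

Hypothesis omf : orbit_map a G f.
Local Notation q := (quotient_map a G).
Let omq := quotient_orbit_map a G.

Let sameV u v : vmap f u = vmap f v <-> vmap q u = vmap q v.
Proof.
split.
  by case/(om_vorbit omf)/orbitP=> g gG <-; rewrite (om_vact omq).
by case/(om_vorbit omq)/orbitP=> g gG <-; rewrite (om_vact omf).
Qed.

Let sameE d e e' : emap f d = inl e' -> emap f e = inl e' -> emap q d = emap q e.
Proof.
by move=> de ee; have /orbitP[g gG <-] := om_eorbit omf de ee; rewrite (om_eact omq).
Qed.

(** [f] and the quotient map identify the same vertices and contract the same edges, so each factors
    through the other. Both factorizations are defined by choosing preimages in [Y]. *)
Lemma orbit_map_induced_iso : induced_iso a f.
Proof.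
have [vO vOP] := fin_all_exists (om_vsurj omq).
have [eA eAP] := fin_all_exists (om_esurj omq).
have [vz vzP] := fin_all_exists (om_vsurj omf).
have [ez ezP] := fin_all_exists (om_esurj omf).
have fvO v : vmap f (vO (vmap q v)) = vmap f v by apply/sameV.
have qvz v : vmap q (vz (vmap f v)) = vmap q v by apply/sameV.
(* The ends of [eA A] lie in different orbits, so [f] cannot contract it. *)
have feA A : exists e', emap f (eA A) = inl e'.
  case fe: (emap f (eA A)) => [e'|z]; first by exists e'.
  have [u euv uv] := ends_other (some_endP (eA A)).
  have [ue ve] : u \in ends (eA A) /\ some_end (eA A) \in ends (eA A).
    by rewrite euv set21 set22.
  case/eqP: uv; apply: (emap_edge_inj (eAP A)) => //.
  by apply/sameV; rewrite !(emap_vert_ends fe).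
have fbarP : is_morphism (Y := qgraph a G) (fun O => vmap f (vO O))
    (fun A => emap f (eA A)).
  move=> A; rewrite -(gmorphP f) (emap_edge_ends (eAP A)) -imset_comp.
  by apply: eq_imset => v; apply: fvO.
have rP : is_morphism (X := qgraph a G) (fun z => vmap q (vz z))
    (fun e' => emap q (ez e')).
  move=> e'; rewrite -(gmorphP q) (emap_edge_ends (ezP e')) -imset_comp.
  by apply: eq_imset => v; apply: qvz.
have fE e : comp_emap (GMorph fbarP) q e = emap f e.
  rewrite /comp_emap; case qe: (emap q e) => [A|O].
    have /orbitP[g gG eg] := om_eorbit omq (eAP A) qe.
    by rewrite /= -eg (om_eact omf).
  case fe: (emap f e) => [e'|z]; last first.
    have ee := some_endP e; rewrite -(emap_vert_ends qe ee) /=.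
    by rewrite fvO (emap_vert_ends fe ee).
  (* Conversely, ends identified by the quotient map are identified by [f], which must then contract
     [e]. *)
  have [u euv uv] := ends_other (some_endP e).
  have [ue ve] : u \in ends e /\ some_end e \in ends e.
    by rewrite euv set21 set22.
  case/eqP: uv; apply: (emap_edge_inj fe) => //.
  by apply/sameV; rewrite !(emap_vert_ends qe).
exists (GMorph fbarP); split; first by split=> // v; apply: fvO.
exists (GMorph rP); split; split=> [O|A] /=.
- rewrite -[RHS]vOP; exact: qvz.
- rewrite /comp_emap /=; have [e' fe] := feA A.
  by rewrite fe; apply: etrans (sameE (ezP e') fe) (eAP A).
- rewrite -[RHS]vzP; exact: fvO.
- by rewrite -[RHS]ezP; apply: fE.
Qed.

End InducedIso.

(** The images in [Y] of two cells with the same image in [X] differ by an element of [gT]; after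
    lifting it to [gT'], what remains is an element of the kernel. *)
Lemma orbit_map_comp (gT' gT : finGroupType) (Z Y X : mgraph)
    (rho : {morphism [set: gT'] >-> gT}) (b : gaction gT' Z) (a : gaction gT Y)
    (h : gmorph Z Y) (f : gmorph Y X) :
  rho @* [set: gT'] = [set: gT] ->
  (forall v g, vmap h (vact b v g) = vact a (vmap h v) (rho g)) ->
  (forall e g, emap h (eact b e g) = cell_act a (emap h e) (rho g)) ->
  orbit_map b ('ker rho)%G h -> orbit_map a [set: gT]%G f ->
  orbit_map b [set: gT']%G (gcomp f h).
Proof.
move=> rhoT hV hE omh omf.
have rho_surj := morphim_full_surj rhoT.
split=> /=.
- by move=> v g _; rewrite hV (om_vact omf) ?inE.
- move=> e g _; rewrite /comp_emap hE; case: (emap h e) => [e'|v] /=.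
    by rewrite (om_eact omf) ?inE.
  by rewrite (om_vact omf) ?inE.
- move=> z; have [v <-] := om_vsurj omf z; have [u <-] := om_vsurj omh v.
  by exists u.
- move=> e'; have [d de'] := om_esurj omf e'; have [e ed] := om_esurj omh d.
  by exists e; rewrite /comp_emap ed.
- move=> u v /(om_vorbit omf)/orbitP[g _]; have [g' <-] := rho_surj g.
  rewrite -hV => vu; have /orbitP[k _ <-] := om_vorbit omh (esym vu).
  by rewrite -actM mem_orbit ?inE.
- move=> d e e'; rewrite /comp_emap.
  case dd: (emap h d) => [d'|//] fd; case ee: (emap h e) => [c|//] fc.
  have /orbitP[g _] := om_eorbit omf fd fc; have [g' <-] := rho_surj g => gd.
  have hg : emap h (eact b e g') = inl d' by rewrite hE ee /= gd.
  have /orbitP[k _ <-] := om_eorbit omh dd hg.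
  by rewrite -actM mem_orbit ?inE.
Qed.

Lemma path_push (Y X : mgraph) (f : gmorph Y X) (B : {set edge Y})
    (A : {set edge X}) :
  (forall e e', e \in B -> emap f e = inl e' -> e' \in A) ->
  forall u v, connect (adj_in B) u v ->
    connect (adj_in A) (vmap f u) (vmap f v).
Proof.
move=> BA; apply: (connect_homo_connect (phi := vmap f)) => u v /adj_inP[e eB euv].
case fe: (emap f e) => [e'|z].
  apply/connect1/adj_inP; exists e'; first exact: BA fe.
  by rewrite (emap_edge_ends fe) euv imsetU1 imset_set1.
by rewrite !(emap_vert_ends fe) ?euv ?set21 ?set22 ?connect0.
Qed.

(** * Fiber components and decomposition groups *)

Section FiberComponent.
Variables (gT : finGroupType) (X : mgraph) (x : vert X) (f : harmonic_cover gT x).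

(** Since [g] permutes the edges of the fiber, the translate of a component stays connected, so it
    remains in the component as soon as one vertex does. *)
Lemma in_decomposition w g :
  (g \in decomposition w) = (vact (cact f) w g \in fiber_component w).
Proof.
have wC : w \in fiber_component w by rewrite inE connect0.
apply/idP/idP => [gN|wg]; first by rewrite astabs_act.
rewrite !inE; apply/subsetP=> u; rewrite !inE => wu.
move: wg; rewrite inE => /connect_trans; apply.
apply: (connect_homo_connect (phi := vact (cact f) ^~ g)) wu.
move=> {}u v /adj_inP[e]; rewrite inE => fe euv.
apply/connect1/adj_inP; exists (eact (cact f) e g).
  by rewrite inE (cover_invariant f).2.
by rewrite ends_eact euv imsetU1 imset_set1.
Qed.

Lemma not_branchP z :
  reflect (forall w g, vmap (cmap f) w = z ->
             vact (cact f) w g \in fiber_component w -> g = 1)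
          (z \notin branch_locus f).
Proof.
rewrite inE negbK; apply: (iffP 'forall_implyP) => [ts w g wz|ts w wz].
  by rewrite -in_decomposition (eqP (ts w _)) ?wz // => /set1P.
apply/eqP/setP=> g; rewrite in_decomposition; apply/idP/set1P.
  by apply: ts; apply/eqP.
by move->; rewrite act1 inE connect0.
Qed.

End FiberComponent.

(** * Orbit representatives *)

Section OrbitReps.
Variables (gT : finGroupType) (T : finType) (to : {action gT &-> T}).

Definition orbit_reps : {set T} := orbit_transversal to [set: gT] [set: T].

Let orbit_repsP := orbit_transversalP
  (introT actsP (fun g _ t => etrans (in_setT (to t g)) (esym (in_setT t)))
    : [acts [set: gT]%G, on [set: T] | to]).

Lemma orbit_reps_inj s t g :
  s \in orbit_reps -> t \in orbit_reps -> to s g = t -> s = t.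
Proof.
move=> sR tR st; have [_ _ repI _] := orbit_repsP.
by apply/eqP; rewrite -repI // -st mem_orbit ?inE.
Qed.

Lemma orbit_reps_cover t : exists2 s, s \in orbit_reps & exists g, to s g = t.
Proof.
have [_ _ _ /(_ t (in_setT t))[g _ tgR]] := orbit_repsP.
by exists (to t g) => //; exists g^-1; rewrite actK.
Qed.

End OrbitReps.

(** * The lifted graph, its action and its map to [Y] *)

Section Lift.
Variables (gT' gT : finGroupType) (rho : {morphism [set: gT'] >-> gT}).
Hypothesis rhoT : rho @* [set: gT'] = [set: gT].
Variables (Y : mgraph) (a : gaction gT Y).

Let rhoM g h : rho (g * h) = rho g * rho h.
Proof. by rewrite morphM ?inE. Qed.

Let rho_ker g h : rho g = rho h -> g^-1 * h \in 'ker rho.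
Proof.
move=> gh; apply/kerP; rewrite ?inE // rhoM -gh -rhoM mulVg.
by rewrite morph1.
Qed.

Definition unramified (v : vert Y) := 'C[v | vact a] == 1.

Lemma unramified_act v g : unramified (vact a v g) = unramified v.
Proof. by rewrite /unramified astab1_act conjsg_eq1. Qed.

(* Each free orbit of vertices is identified with [gT] through its point in
   [orbit_reps] and lifted to [gT']; the other vertices lift to themselves. *)
Definition lvert : finType :=
  ({v | (v \in orbit_reps (vact a)) && unramified v} * gT'
   + {v | ~~ unramified v})%type.

Lemma ramified_act (v : {v | ~~ unramified v}) g :
  ~~ unramified (vact a (val v) g).
Proof. by rewrite unramified_act (valP v). Qed.

Definition lvact_fun (u : lvert) (g : gT') : lvert :=
  match u with
  | inl (t, h) => inl (t, h * g)
  | inr v => inr (exist (fun v => ~~ unramified v) _ (ramified_act v (rho g)))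
  end.

Lemma lvact1 u : lvact_fun u 1 = u.
Proof.
case: u => [[t h]|v] /=; first by rewrite mulg1.
by congr inr; apply: val_inj; rewrite /= morph1 act1.
Qed.

Lemma lvactM u : act_morph lvact_fun u.
Proof.
move=> g h; case: u => [[t k]|v] /=; first by rewrite mulgA.
by congr inr; apply: val_inj; rewrite /= rhoM actM.
Qed.

Definition lvact : {action gT' &-> lvert} := TotalAction lvact1 lvactM.

Definition lvmap (u : lvert) : vert Y :=
  match u with inl (t, g) => vact a (val t) (rho g) | inr v => val v end.

Lemma lvmap_act u g : lvmap (lvact u g) = vact a (lvmap u) (rho g).
Proof. by case: u => [[t h]|v] //=; rewrite rhoM actM. Qed.

Lemma lvmap_surj v : exists u, lvmap u = v.
Proof.
case vU: (unramified v); last first.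
  by exists (inr (exist (fun v => ~~ unramified v) v (negbT vU))).
have [t tR [g tg]] := orbit_reps_cover (vact a) v.
have tU : unramified t by rewrite -(unramified_act t g) tg.
have tP : (t \in orbit_reps (vact a)) && unramified t by rewrite tR.
have [g' rg'] := morphim_full_surj rhoT g; exists (inl (exist _ t tP, g')).
by rewrite /= rg'.
Qed.

(** Such a vertex lies in a copy of [gT'], on which the action is by translation. *)
Lemma lvact_free u g : unramified (lvmap u) -> lvact u g = u -> g = 1.
Proof.
case: u => [[t h]|v] /=; last by rewrite (negbTE (valP v)).
by move=> _ [] /(canRL (mulKg h)); rewrite mulVg.
Qed.

(** A ramified vertex has a single lift. Two lifts of an unramified one share their representative,
    whose trivial inertia forces their group coordinates to agree under [rho]. *)
Lemma lvmap_orbit u v : lvmap u = lvmap v -> u \in orbit lvact ('ker rho) v.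
Proof.
have inlN (t : {v | (v \in orbit_reps (vact a)) && unramified v}) g w :
  vact a (val t) (rho g) = val (w : {v | ~~ unramified v}) -> False.
  move=> tw; have /negP[] := valP w.
  by rewrite -tw unramified_act; case/andP: (valP t).
case: u v => [[s g]|w] [[t h]|z] /=.
- move=> st; have [/andP[sR sU] /andP[tR _]] := (valP s, valP t).
  have stE : vact a (val s) (rho (g * h^-1)) = val t.
    by rewrite rhoM actM st -actM -rhoM mulgV morph1 act1.
  have {}stE : s = t by apply: val_inj; apply: orbit_reps_inj stE.
  subst t; apply/orbitP; exists (h^-1 * g); last by rewrite /= mulKVg.
  apply: rho_ker; apply/eqP; rewrite eq_mulgV1.
  have : rho h * (rho g)^-1 \in 'C[val s | vact a].
    by apply/astab1P; rewrite actM -st -actM mulgV act1.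
  by rewrite (eqP sU) inE.
- by move/inlN.
- by move/esym/inlN.
- by move/val_inj->; apply: orbit_refl.
Qed.

Variable v0 : lvert.

(** The second summand gives the edges from [v0] to its translates under the kernel; a [k] fixing
    [v0] would give a loop. The factor [gT'] makes the action free: if [k] is an involution, the
    edge from [v0] to its translate and the image of that edge under [k] are distinct parallel
    edges, so nothing is flipped. *)
Definition ledge : finType :=
  (({e | e \in orbit_reps (eact a)}
    + {k | (k \in 'ker rho) && (lvact v0 k != v0)}) * gT')%type.


Let lsection_ex v : exists u, lvmap u == v.
Proof. by have [u <-] := lvmap_surj v; exists u. Qed.

Definition lsection (v : vert Y) : lvert := xchoose (lsection_ex v).

Lemma lsectionK : cancel lsection lvmap.
Proof. by move=> v; apply/eqP/(xchooseP (lsection_ex v)). Qed.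

Definition lends (c : ledge) : {set lvert} :=
  [set lvact u c.2 | u in match c.1 with
                          | inl e => lsection @: ends (val e)
                          | inr k => [set v0; lvact v0 (val k)]
                          end].

Lemma card_lends c : #|lends c| = 2.
Proof.
rewrite /lends card_imset; last exact: act_inj.
case: c => [[e|k] g] /=.
  by rewrite card_imset ?card_ends //; apply: can_inj lsectionK.
by rewrite cards2 eq_sym; case/andP: (valP k) => _ ->.
Qed.

Definition lgraph : mgraph := MGraph card_lends.

Definition leact_fun (c : ledge) (g : gT') : ledge := (c.1, c.2 * g).

Lemma leact1 c : leact_fun c 1 = c.
Proof. by case: c => c g; rewrite /leact_fun /= mulg1. Qed.

Lemma leactM c : act_morph leact_fun c.
Proof. by move=> g h; rewrite /leact_fun /= mulgA. Qed.

Definition leact : {action gT' &-> ledge} := TotalAction leact1 leactM.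

Lemma lends_act c g : lends (leact c g) = [set lvact u g | u in lends c].
Proof.
by rewrite /lends -imset_comp; apply: eq_imset => u; apply: (actM lvact).
Qed.

Definition laction : gaction gT' lgraph :=
  @GAction gT' lgraph lvact leact lends_act.

Definition lemap (c : ledge) : edge Y + vert Y :=
  match c.1 with
  | inl e => inl (eact a (val e) (rho c.2))
  | inr _ => inr (vact a (lvmap v0) (rho c.2))
  end.

Lemma lmap_subproof : is_morphism (Y := lgraph) (X := Y) lvmap lemap.
Proof.
move=> [[e|k] g] /=; rewrite /lemap /lends /= -imset_comp.
  rewrite ends_eact -imset_comp; apply: eq_imset => v /=.
  by rewrite lvmap_act lsectionK.
have /andP[kK _] := valP k.
by rewrite imsetU1 imset_set1 /comp !lvmap_act (mker kK) act1 setUid.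
Qed.

Definition lmap : gmorph lgraph Y := GMorph lmap_subproof.

Lemma lmap_vact v g :
  vmap lmap (vact laction v g) = vact a (vmap lmap v) (rho g).
Proof. exact: lvmap_act. Qed.

Lemma lmap_eact e g :
  emap lmap (eact laction e g) = cell_act a (emap lmap e) (rho g).
Proof. by case: e => [[e|k] h]; rewrite /= /lemap /= rhoM actM. Qed.

Lemma laction_unflipped : unflipped laction.
Proof.
by case=> c h g [] /(canRL (mulKg h)); rewrite mulVg.
Qed.

Hypothesis ufl : unflipped a.

(** Edges are treated like unramified vertices, with freeness on edges in place of trivial inertia;
    the added edges are all contracted. *)
Lemma lmap_orbit_map : orbit_map laction ('ker rho) lmap.
Proof.
split=> /=.
- by move=> v g gK; rewrite lvmap_act mker ?act1.
- by move=> [[e|k] h] g gK; rewrite /lemap /= rhoM (mker gK) mulg1.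
- exact: lvmap_surj.
- move=> e; have [r rR [g rg]] := orbit_reps_cover (eact a) e.
  have [g' rg'] := morphim_full_surj rhoT g; exists (inl (exist _ r rR), g').
  by rewrite /lemap /= rg' rg.
- exact: lvmap_orbit.
- move=> [[d|k] g] [[e|l] h] e' //= []; rewrite /lemap /= => dg [eh].
  have deE : eact a (val d) (rho (g * h^-1)) = val e.
    by rewrite rhoM actM dg -eh -actM -rhoM mulgV morph1 act1.
  have {}deE : d = e.
    by apply: val_inj; apply: orbit_reps_inj (valP d) (valP e) deE.
  subst d; apply/orbitP; exists (h^-1 * g); last by rewrite /= /leact_fun mulKVg.
  by apply: rho_ker; apply: (unflipped_inj ufl (e := val e)); rewrite eh.
Qed.

(** A path in [Y] from the image of [u] to that of [v0] lifts to a path from [u] to a translate of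
    [v0] under the kernel, which is [v0] itself or joined to it by an added edge. *)
Lemma lgraph_connected : connected Y -> connected lgraph.
Proof.
move=> cY.
suff cv0 u : connect (adj_in [set: edge lgraph]) u v0.
  move=> u v; rewrite inE (connect_trans (cv0 v)) //.
  by rewrite connect_adj_in_sym.
have uv0 : connect (adj_in [set: edge Y]) (vmap lmap u) (lvmap v0).
  by have := cY (lvmap v0) (lvmap u); rewrite inE.
have [|w /= wv0 uw] := path_lift lmap_orbit_map (B := [set: edge lgraph]) _ uv0.
  by move=> *; rewrite inE.
apply: connect_trans uw _; rewrite (@connect_adj_in_sym lgraph).
have /orbitP[k kK <-] := lvmap_orbit wv0.
have [->|kv0] := eqVneq (lvact v0 k) v0; first exact: connect0.
have kP : (k \in 'ker rho) && (lvact v0 k != v0) by rewrite kK.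
apply/connect1/adj_inP; exists (inr (exist _ k kP), 1); rewrite ?inE //=.
by rewrite /lends /= imsetU1 imset_set1 !lvact1.
Qed.

Lemma laction_faithful :
  connected Y -> faithful_gaction a -> faithful_gaction laction.
Proof.
move=> cY fa g gV gE; have [e _|noE] := pickP (@predT ledge).
  exact: (laction_unflipped (gE e)).
(* Without edges, [Y] is a single vertex; faithfulness then makes [gT] trivial, so this vertex is
   unramified and [gT'] acts freely above it. *)
have noEY (e : edge Y) : False.
  by have [e' _] := om_esurj lmap_orbit_map e; have := noE e'.
apply: (@lvact_free v0); last exact: gV.
rewrite /unramified -subG1; apply/subsetP=> h /astab1P hv0; apply/set1P.
apply: fa => [v|e]; last by case: (noEY e).
suff -> : v = lvmap v0 by [].
have := cY v (lvmap v0); rewrite inE => /connectP[[|w p] //=].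
by case/andP=> /adj_inP[e]; case: (noEY e).
Qed.

End Lift.

(** * The lifted cover: domination, inertia and branch locus *)

Section LiftedCover.
Variables (X : mgraph) (x : vert X) (gT' gT : finGroupType).
Variables (f : harmonic_cover gT x) (rho : {morphism [set: gT'] >-> gT}).
Hypothesis rhoT : rho @* [set: gT'] = [set: gT].
Variable v0 : lvert gT' (cact f).

Let a := cact f.
Let ufl : unflipped a := @cover_unflipped _ _ _ f.
Let h := lmap rhoT v0.
Let b := laction rhoT v0.

Let omf : orbit_map a [set: gT]%G (cmap f).
Proof.
exact: induced_iso_orbit_map (cover_invariant f) (cover_quotient f).
Qed.

Let omh : orbit_map b ('ker rho) h.
Proof. exact: lmap_orbit_map ufl. Qed.

Let omfh : orbit_map b [set: gT']%G (gcomp (cmap f) h).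
Proof.
apply: orbit_map_comp rhoT _ _ omh omf; first exact: lmap_vact.
exact: lmap_eact.
Qed.

Let cl : connected (lgraph rhoT v0).
Proof. exact: lgraph_connected ufl (@cover_connected _ _ _ f). Qed.

Let fl : faithful_gaction b.
Proof.
exact: laction_faithful ufl (@cover_connected _ _ _ f) (@cover_faithful _ _ _ f).
Qed.

Let ul : unflipped b.
Proof. exact: laction_unflipped. Qed.

Let base_fh : vmap (gcomp (cmap f) h) (lsection rhoT a (cbase f)) = x.
Proof. by rewrite /= lsectionK cover_base. Qed.

Let inv_fh : invariant_gmorph b (gcomp (cmap f) h).
Proof.
by split=> u g; [apply: (om_vact omfh) | apply: (om_eact omfh)]; rewrite inE.
Qed.

Definition lcover : harmonic_cover gT' x :=
  HarmonicCover cl fl (unflipped_harmonic_action cl fl ul) ul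
    (orbit_map_harmonic omfh ul) base_fh inv_fh (orbit_map_induced_iso omfh).

Lemma lcover_dominates : dominates rho lcover f.
Proof.
exists h; split=> //; first exact: orbit_map_harmonic omh ul.
- exact: lsectionK.
- exact: lmap_vact.
- exact: lmap_eact.
Qed.

(** Only inertia matters here, and the added edges do not change it. *)
Lemma lcover_etale : etale f -> etale lcover.
Proof.
move=> et u; apply/trivgP/subsetP=> g /astab1P gu; apply/set1P.
by apply: lvact_free gu; apply/eqP/et.
Qed.

Lemma lcover_branch_locus :
  vmap (cmap f) (lvmap rho v0) \in branch_locus f ->
  branch_locus lcover = branch_locus f.
Proof.
move=> v0B; apply/setP=> z; apply: negb_inj; apply/idP/idP => zN.
  move: (zN) => /not_branchP ts; apply/not_branchP => w g.
  have [u <-] := om_vsurj omh w => uz.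
  pose B := fiber_edges lcover (vmap (cmap lcover) u).
  (* A path in the fiber of [f] from [w] to its translate by [g] lifts into the fiber of [lcover].
     Its endpoint is a translate of [u] by a lift of [g], and total splitting makes that lift
     trivial. *)
  rewrite inE => wg; have [|v hv uv] := path_lift omh (B := B) _ wg.
    by move=> e e' he; rewrite !inE /= /comp_emap he.
  have [g' rg'] := morphim_full_surj rhoT g.
  have /(om_vorbit omh)/orbitP[k kK vE] : vmap h v = vmap h (vact b u g').
    by rewrite hv -rg'; apply/esym/lmap_vact.
  have ugk : vact b u (g' * k) = v by rewrite actM.
  have gk : g' * k = 1.
    by apply: (ts u _ uz); rewrite inE [vact _ _ _]ugk; apply: uv.
  by rewrite -rg' -(morph1 rho) -gk morphM ?inE // (mker kK) mulg1.
move: (zN) => /not_branchP ts; apply/not_branchP => u g uz.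
(* Added edges lie over a branch point, hence not over [z]. A lifted edge over [z] would come from
   an edge of [Y] in the fiber, whose distinct ends lie in one orbit and one component, against
   total splitting. *)
have no_vertical e : emap (cmap lcover) e != inr z.
  apply/negP; rewrite /= /comp_emap => /eqP.
  case: e => [[e|k] k']; rewrite /lemap /=; last first.
    case=> z0; case/negP: zN; by rewrite -z0 (om_vact omf) // in_setT.
  set e' := (X in emap _ X) => fe'.
  have [v eE neq] := ends_other (some_endP e').
  have [fu fv] : vmap (cmap f) (some_end e') = z /\ vmap (cmap f) v = z.
    by split; apply: (emap_vert_ends fe'); rewrite eE ?set21 ?set22.
  have /(om_vorbit omf)/orbitP[g' _ vE] :
      vmap (cmap f) v = vmap (cmap f) (some_end e').
    by rewrite fu fv.
  case/eqP: neq; rewrite -vE (ts _ g' fu) ?act1 // vE inE.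
  by apply/connect1/adj_inP; exists e'; rewrite // inE fu fe'.
(* The component of [u] thus reduces to [u], and only its inertia remains. *)
rewrite inE => /connectP[[|v p] /=]; last first.
  case/andP=> /adj_inP[e]; rewrite inE => ez; case/negP: (no_vertical e).
  by rewrite -uz.
move=> _ ug; apply: lvact_free ug.
apply/eqP/trivgP/subsetP=> k /astab1P uk; apply/set1P/(ts _ k uz).
by rewrite uk inE connect0.
Qed.

End LiftedCover.

Theorem theorem6p1 (X : mgraph) (x : vert X) (connX : connected X)
    (kT gT' gT : finGroupType) (f : harmonic_cover gT x)
    (iota : {morphism [set: kT] >-> gT'}) (rho : {morphism [set: gT'] >-> gT})
    (iota_inj : 'injm iota)
    (exact_mid : iota @* [set: kT] = 'ker rho)
    (rho_surj : rho @* [set: gT'] = [set: gT]) :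
  (exists f' : harmonic_cover gT' x, dominates rho f' f) /\
  (etale f ->
     exists f' : harmonic_cover gT' x, etale f' /\ dominates rho f' f) /\
  (branch_locus f <> set0 ->
     exists f' : harmonic_cover gT' x,
       dominates rho f' f /\ branch_locus f' = branch_locus f).
Proof.
(* Any vertex can serve as [v0] in the first two claims. *)
have v0 := lsection rho_surj (cact f) (cbase f); split; last split.
- by exists (lcover rho_surj v0); apply: lcover_dominates.
- by exists (lcover rho_surj v0); split;
    [apply: lcover_etale | apply: lcover_dominates].
(* Here [v0] is put above a vertex [w] with nontrivial decomposition group, so that the added edges
   lie over a branch point. *)
move/eqP/set0Pn=> [z]; rewrite inE negb_forall => /existsP[w].
rewrite negb_imply => /andP[/eqP wz ramw].
exists (lcover rho_surj (lsection rho_surj (cact f) w)); split.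
  exact: lcover_dominates.
apply: lcover_branch_locus; rewrite lsectionK inE negb_forall.
by apply/existsP; exists w; rewrite eqxx.
Qed.
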